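(* Let $h:G_1\to G_2$ be a homomorphism of groups and let $I:=\operatorname{Im} h$. Then the algebraic pullback functor $h^{\ast}$ has nullity zero if and only if $I$ is contranormal in $G_2$.
   Context: Groups are arbitrary (not necessarily finite). For a group $G$, $G\text{-}\mathbf{set}$ denotes the category of (not necessarily finite or nonempty) right $G$-sets with $G$-equivariant functions as morphisms. For a homomorphism $h:G_1\to G_2$, the algebraic pullback functor $h^{\ast}:G_2\text{-}\mathbf{set}\to G_1\text{-}\mathbf{set}$ is defined on objects by $h^{\ast}(S):=S$ (same underlying set) with action $s\cdot g_1:=s\cdot h(g_1)$, and on morphisms by $h^{\ast}(t):=t$. For $L$ a subgroup of $G$, $L\backslash G$ is the right $G$-set of right cosets $Lg$, with $G$ acting by right translation. For a cardinal number $c$ and a $G$-set $S$, $c\cdot S$ is the disjoint union of $c$ copies of $S$. A $G$-set is trivial if it is isomorphic to $c\cdot(G\backslash G)$ for some cardinal number $c$ (here $G\backslash G$ is the one-point $G$-set). The functor $h^{\ast}$ has nullity zero provided that for every $G_2$-set $S$, if $h^{\ast}(S)$ is a trivial $G_1$-set then $S$ is a trivial $G_2$-set. A subgroup $L$ of $G$ is contranormal in $G$ if the normal closure of $L$ in $G$ (the subgroup generated by all $g^{-1}Lg$, $g\in G$) equals $G$. *)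

(* Defs.v *)
From mathcomp Require Import all_boot.
From mathcomp Require Import boolp classical_sets.

Set Implicit Arguments.
Unset Strict Implicit.
Unset Printing Implicit Defensive.

Local Open Scope classical_set_scope.
Local Open Scope group_scope.

(* A [groupType] is an arbitrary, possibly infinite, group. Its [choiceType]
   component is no restriction: classically every type carries one. *)

Record subgroup (G : groupType) := Subgroup {
  subgroup_set :> set G;
  subgroup1 : subgroup_set 1;
  subgroupM : forall x y, subgroup_set x -> subgroup_set y ->
    subgroup_set (x * y);
  subgroupV : forall x, subgroup_set x -> subgroup_set x^-1
}.

Definition full_subgroup (G : groupType) : subgroup G :=
  @Subgroup G [set: G] I (fun _ _ _ _ => I) (fun _ _ => I).

Section Generated.
Variables (G : groupType) (A : set G).

Definition generated_set : set G :=
  \bigcap_(H in [set H : subgroup G | A `<=` H]) H.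

Lemma generated_set1 : generated_set 1.
Proof. by move=> H _; apply: subgroup1. Qed.

Lemma generated_setM x y :
  generated_set x -> generated_set y -> generated_set (x * y).
Proof. by move=> gx gy H AH; apply: subgroupM; [exact: gx | exact: gy]. Qed.

Lemma generated_setV x : generated_set x -> generated_set x^-1.
Proof. by move=> gx H AH; apply: subgroupV; exact: gx. Qed.

Definition generated : subgroup G :=
  Subgroup generated_set1 generated_setM generated_setV.

End Generated.

(* [x ^ g] is the conjugate [g^-1 * (x * g)]. *)
Definition normal_closure (G : groupType) (L : subgroup G) : subgroup G :=
  generated (\bigcup_(g in [set: G]) [set x ^ g | x in L]).

Definition contranormal (G : groupType) (L : subgroup G) : Prop :=
  normal_closure L = [set: G] :> set G.

Section Image.
Variables (G1 G2 : groupType) (h : UMagmaMorphism.type G1 G2).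

Lemma image_subgroup1 : range h 1.
Proof. by exists 1 => //; apply: gmulf1. Qed.

Lemma image_subgroupM x y : range h x -> range h y -> range h (x * y).
Proof. by move=> [a _ <-] [b _ <-]; exists (a * b) => //; apply: gmulfM. Qed.

Lemma image_subgroupV x : range h x -> range h x^-1.
Proof. by move=> [a _ <-]; exists a^-1 => //; apply: gmulfV. Qed.

Definition image_subgroup : subgroup G2 :=
  Subgroup image_subgroup1 image_subgroupM image_subgroupV.

End Image.

Record gset (G : groupType) := GSet {
  carrier :> Type;
  act : carrier -> G -> carrier;
  act1 : forall s, act s 1 = s;
  actM : forall s g k, act s (g * k) = act (act s g) k
}.

Record gmap (G : groupType) (S T : gset G) := GMap {
  gmap_fun :> S -> T;
  gmap_act : forall s g, gmap_fun (act s g) = act (gmap_fun s) g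
}.

Definition gmap_id (G : groupType) (S : gset G) : gmap S S :=
  @GMap G S S id (fun _ _ => erefl).

Section Comp.
Variables (G : groupType) (S T U : gset G) (u : gmap T U) (t : gmap S T).

Lemma gmap_comp_act s g : (u \o t) (act s g) = act ((u \o t) s) g.
Proof. by rewrite /= !gmap_act. Qed.

Definition gmap_comp : gmap S U := GMap gmap_comp_act.

End Comp.

Definition gset_iso (G : groupType) (S T : gset G) : Prop :=
  exists (t : gmap S T) (u : gmap T S),
    gmap_comp u t =1 gmap_id S /\ gmap_comp t u =1 gmap_id T.

Record gfunctor (G2 G1 : groupType) := GFunctor {
  fobj :> gset G2 -> gset G1;
  fmap : forall S T, gmap S T -> gmap (fobj S) (fobj T);
  fmap_id : forall S, fmap (gmap_id S) =1 gmap_id (fobj S);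
  fmap_comp : forall S T U (u : gmap T U) (t : gmap S T),
    fmap (gmap_comp u t) =1 gmap_comp (fmap u) (fmap t)
}.

Section Cosets.
Variables (G : groupType) (L : subgroup G).

Definition right_coset (g : G) : set G := [set x * g | x in L].

Definition is_right_coset (A : set G) : Prop := exists g, A = right_coset g.

Definition translate (A : set G) (g : G) : set G := [set x * g | x in A].

Lemma translateM A g k : translate A (g * k) = translate (translate A g) k.
Proof.
apply/seteqP; split=> [_ [x Ax <-]|_ [_ [x Ax <-] <-]].
  by exists (x * g); [exists x | rewrite mulgA].
by exists x => //; rewrite mulgA.
Qed.

Lemma translate1 A : translate A 1 = A.
Proof.
apply/seteqP; split=> [_ [x Ax <-]|x Ax]; first by rewrite mulg1.
by exists x => //; rewrite mulg1.
Qed.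

Lemma translate_coset A g : is_right_coset A -> is_right_coset (translate A g).
Proof. by move=> [k ->]; exists (k * g); rewrite -translateM. Qed.

Definition coset_act (A : {A : set G | is_right_coset A}) (g : G) :
    {A : set G | is_right_coset A} :=
  exist _ (translate (sval A) g) (translate_coset g (svalP A)).

Lemma coset_act1 A : coset_act A 1 = A.
Proof. by case: A => A hA; apply: eq_exist; exact: translate1. Qed.

Lemma coset_actM A g k : coset_act A (g * k) = coset_act (coset_act A g) k.
Proof. by apply: eq_exist; exact: translateM. Qed.

Definition coset_gset : gset G := GSet coset_act1 coset_actM.

End Cosets.

(* A cardinal number is represented by a type of that cardinality. *)
Section Copies.
Variables (c : Type) (G : groupType) (S : gset G).

Definition copies_act (p : c * S) (g : G) : c * S := (p.1, act p.2 g).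

Lemma copies_act1 p : copies_act p 1 = p.
Proof. by case: p => i s; rewrite /copies_act /= act1. Qed.

Lemma copies_actM p g k : copies_act p (g * k) = copies_act (copies_act p g) k.
Proof. by rewrite /copies_act /= actM. Qed.

Definition copies : gset G := GSet copies_act1 copies_actM.

End Copies.

Definition trivial_gset (G : groupType) (S : gset G) : Prop :=
  exists c : Type, gset_iso S (copies c (coset_gset (full_subgroup G))).

Section Pullback.
Variables (G1 G2 : groupType) (h : UMagmaMorphism.type G1 G2).

Section Objects.
Variable S : gset G2.

Definition pullback_act (s : S) (g : G1) : S := act s (h g).

Lemma pullback_act1 s : pullback_act s 1 = s.
Proof. by rewrite /pullback_act gmulf1 act1. Qed.

Lemma pullback_actM s g k :
  pullback_act s (g * k) = pullback_act (pullback_act s g) k.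
Proof. by rewrite /pullback_act gmulfM actM. Qed.

Definition pullback_obj : gset G1 := GSet pullback_act1 pullback_actM.

End Objects.

Definition pullback_map (S T : gset G2) (t : gmap S T) :
    gmap (pullback_obj S) (pullback_obj T) :=
  @GMap G1 (pullback_obj S) (pullback_obj T) t (fun s g => gmap_act t s (h g)).

Definition pullback : gfunctor G2 G1 :=
  @GFunctor G2 G1 pullback_obj pullback_map
    (fun _ _ => erefl) (fun _ _ _ _ _ _ => erefl).

End Pullback.

Definition nullity_zero (G2 G1 : groupType) (F : gfunctor G2 G1) : Prop :=
  forall S : gset G2, trivial_gset (F S) -> trivial_gset S.

(* Main.v *)
Require Import Defs.
From mathcomp Require Import all_boot.
From mathcomp Require Import boolp classical_sets.

(** A G-set is trivial exactly when G fixes all its points. If [I] is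
contranormal and fixes every point of [S], the kernel of the action on [S] is a
subgroup containing all conjugates of [I], hence is the whole of [G2].
Conversely, let [N] be the normal closure of [I]. Since [N] contains all
conjugates of [I], the group [G1] fixes every coset [N k]; by nullity zero so
does [G2], and [N g = N] for all [g] means [N = G2]. *)

Set Implicit Arguments.
Unset Strict Implicit.
Unset Printing Implicit Defensive.

Local Open Scope classical_set_scope.
Local Open Scope group_scope.

Lemma sub_generated (G : groupType) (A : set G) : A `<=` generated A.
Proof. by move=> x Ax H AH; apply: AH. Qed.

Lemma generated_sub (G : groupType) (A : set G) (H : subgroup G) :
  A `<=` H -> generated A `<=` H.
Proof. by move=> AH x; apply. Qed.

Lemma right_coset_self (G : groupType) (L : subgroup G) g : right_coset L g g.
Proof. by exists 1; [exact: subgroup1 | rewrite mul1g]. Qed.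

Lemma eq_right_coset (G : groupType) (L : subgroup G) (g k : G) :
  subgroup_set L (g * k^-1) -> right_coset L g = right_coset L k.
Proof.
move=> Lgk; apply/seteqP; split=> _ [x Lx <-].
  by exists (x * (g * k^-1)); [exact: subgroupM | rewrite !mulgA mulgVK].
exists (x * (g * k^-1)^-1); first by apply: subgroupM => //; exact: subgroupV.
by rewrite invgM invgK !mulgA mulgVK.
Qed.

Lemma right_coset_full (G : groupType) (g : G) :
  right_coset (full_subgroup G) g = [set: G].
Proof.
by apply/seteqP; split=> // x _; exists (x * g^-1) => //; rewrite mulgVK.
Qed.

Lemma coset_full_eq (G : groupType) (A B : coset_gset (full_subgroup G)) :
  A = B.
Proof.
case: A B => [A cA] [B cB]; apply: eq_exist.
by case: cA => a ->; case: cB => b ->; rewrite !right_coset_full.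
Qed.

Lemma trivial_gsetP (G : groupType) (S : gset G) :
  trivial_gset S <-> forall (s : S) g, act s g = s.
Proof.
split=> [[c [t [u [ut _]]]] s g|fixS].
  (* Transported along [t], the action moves only the second coordinate, which lives in a one-point
     set. *)
  rewrite -[LHS]ut -[RHS]ut /= gmap_act; congr (u _).
  case: (t s) => i A.
  by rewrite /= /copies_act; congr pair; exact: coset_full_eq.
pose T := coset_gset (full_subgroup G).
have coset1 : is_right_coset (full_subgroup G) (right_coset (full_subgroup G) 1).
  by exists 1.
pose pt : T := exist _ _ coset1.
have t_act (s : S) g : (act s g, pt) = @act G (copies S T) (s, pt) g.
  by rewrite fixS /= /copies_act; congr pair; exact: coset_full_eq.
have u_act (p : copies S T) g : (act p g).1 = act p.1 g by rewrite fixS.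
(* The cardinal is that of [S] itself: each point is its own orbit. *)
exists S, (GMap (T := copies S T) t_act), (GMap u_act); split=> // -[s A].
by congr pair; exact: coset_full_eq.
Qed.

Section ActionKernel.
Variables (G : groupType) (S : gset G).

Definition action_kernel_set : set G := [set g | forall s : S, act s g = s].

Lemma action_kernel1 : action_kernel_set 1.
Proof. exact: act1. Qed.

Lemma action_kernelM x y :
  action_kernel_set x -> action_kernel_set y -> action_kernel_set (x * y).
Proof. by move=> Kx Ky s; rewrite actM Kx Ky. Qed.

Lemma action_kernelV x : action_kernel_set x -> action_kernel_set x^-1.
Proof. by move=> Kx s; rewrite -[in LHS](Kx s) -actM mulgV act1. Qed.

Definition action_kernel : subgroup G :=
  Subgroup action_kernel1 action_kernelM action_kernelV.

(** The kernel is normal: in $s \cdot g^{-1}xg$ the element $x$ fixes $s \cdot g^{-1}$, and $g$ then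
    brings this point back to $s$. *)
Lemma normal_closure_sub_kernel (L : subgroup G) :
  L `<=` action_kernel -> normal_closure L `<=` action_kernel.
Proof.
move=> LK; apply: generated_sub => _ [g _ [x Lx <-]] s.
by rewrite conjgE !actM (LK x Lx) -actM mulVg act1.
Qed.

End ActionKernel.

(** With $N$ the normal closure of $L$, $Nkx = N(kxk^{-1})k = Nk$, as $kxk^{-1}$ is a conjugate of
    $x \in L$. *)
Lemma act_normal_closure_coset (G : groupType) (L : subgroup G)
    (A : coset_gset (normal_closure L)) (x : G) : subgroup_set L x -> act A x = A.
Proof.
case: A => A cA Lx; apply: eq_exist => /=; case: cA => k ->.
(* [right_coset L k] unfolds to the translate of [L] by [k], so [translateM] merges the two
   translations. *)
rewrite /right_coset -/(translate _ _) -translateM; apply: eq_right_coset.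
apply: sub_generated; exists k^-1 => //; exists x => //.
by rewrite conjgE invgK mulgA.
Qed.

Theorem theorem4p1 (G1 G2 : groupType)
    (h : UMagmaMorphism.type G1 G2) :
  nullity_zero (pullback h) <-> contranormal (image_subgroup h).
Proof.
split=> [h0|cI S /trivial_gsetP fixS].
  apply/seteqP; split=> // g _.
  set N := normal_closure _.
  have /trivial_gsetP fixN : trivial_gset (coset_gset N).
    apply/h0/trivial_gsetP => A a.
    by apply: act_normal_closure_coset; exists a.
  have coset1 : is_right_coset N (right_coset N 1) by exists 1.
  (* Fixing the base coset $N1$ already suffices: it yields $(N1)g = N1$ as sets. *)
  have /(congr1 sval) /= N1g := fixN (exist _ _ coset1) g.
  have : right_coset N 1 g.
    rewrite -N1g /right_coset -/(translate _ _) -translateM mul1g.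
    exact: right_coset_self.
  by case=> x Nx <-; rewrite mulg1.
apply/trivial_gsetP => s g.
have : subgroup_set (normal_closure (image_subgroup h)) g by rewrite cI.
move/normal_closure_sub_kernel; apply=> _ [a _ <-] t.
(* The pulled-back action of [a] is by definition that of [h a]. *)
exact: fixS t a.
Qed.
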